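(* For all $n\ge1$, we have $c_n(1132,2213,2231)=C_{n+1}-1$.
   Context: A word $\pi=\pi_1\dots\pi_m$ over the positive integers contains the pattern $\sigma=\sigma_1\dots\sigma_k$ if there are indices $1\le i_1<\dots<i_k\le m$ such that for all $r,s\in\{1,\dots,k\}$: $\pi_{i_r}<\pi_{i_s}$ iff $\sigma_r<\sigma_s$, and $\pi_{i_r}=\pi_{i_s}$ iff $\sigma_r=\sigma_s$; otherwise $\pi$ avoids $\sigma$. The set of nonnesting permutations consists of the arrangements (words) of the multiset $\{1,1,2,2,\dots,n,n\}$ that avoid the patterns $1221$ and $2112$. For patterns $\sigma,\tau,\dots$, $c_n(\sigma,\tau,\dots)$ is the number of nonnesting permutations of $\{1,1,2,2,\dots,n,n\}$ avoiding all of $\sigma,\tau,\dots$. $C_n=\frac{1}{n+1}\binom{2n}{n}$ is the $n$th Catalan number. *)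

(* Defs.v *)
From mathcomp Require Import all_boot.

Set Implicit Arguments.
Unset Strict Implicit.
Unset Printing Implicit Defensive.

(* Words over the positive integers, and patterns, are sequences of naturals;
   positions are numbered from 0. *)
Definition contains (w s : seq nat) : bool :=
  [exists i : {ffun 'I_(size s) -> 'I_(size w)},
    [forall r : 'I_(size s), forall t : 'I_(size s),
       (r < t) ==> (i r < i t)] &&
    [forall r : 'I_(size s), forall t : 'I_(size s),
       ((nth 0 w (i r) < nth 0 w (i t)) == (nth 0 s r < nth 0 s t)) &&
       ((nth 0 w (i r) == nth 0 w (i t)) == (nth 0 s r == nth 0 s t))]].

Definition avoids (w s : seq nat) : bool := ~~ contains w s.

(* The multiset {1, 1, 2, 2, ..., n, n}. *)
Definition double_multiset (n : nat) : seq nat :=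
  flatten [seq [:: k; k] | k <- iota 1 n].

(* [permutations s] lists each distinct rearrangement of [s] exactly once. *)
Definition nonnesting (n : nat) : seq (seq nat) :=
  [seq w <- permutations (double_multiset n) |
     avoids w [:: 1; 2; 2; 1] && avoids w [:: 2; 1; 1; 2]].

Definition c (n : nat) (ps : seq (seq nat)) : nat :=
  size [seq w <- nonnesting n | all (avoids w) ps].

(* The division is exact. *)
Definition catalan (n : nat) : nat := 'C(2 * n, n) %/ n.+1.

(* Main.v *)
Require Import Defs.
From mathcomp Require Import all_boot.
From mathcomp Require Import zify.

Set Implicit Arguments.
Unset Strict Implicit.
Unset Printing Implicit Defensive.

(** A nonnesting word opens and closes its letters (shows their first and second
    copies) in the same order, so it amounts to a permutation, the opening order,
    together with a Dyck word of opening and closing moves ([fifo_exists],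
    [fifo_inj]). At the moment when a letter h is closed, all the letters after h
    in the opening order have their second copy ahead, and the patterns 1132,
    2213 and 2231 restrict only what follows this moment ([admissible_step]). By
    2213 and 2231, h is the largest or the smallest of the letters of the rest
    of the word. If it is the largest, nothing else is required. If it is the
    smallest, 1132 forces the rest of the word to be sorted, hence determines it.

    So the opening order is n, n-1, ..., n-j+1, 1, 2, ..., n-j for some j < n, and
    the Dyck word is free until the closing number j + 1 and forced from there on
    ([admissible_shape], [shape_admissible]). An admissible word is therefore the
    same thing as the part of its Dyck word before the closing number j + 1: a
    ballot word with u openings and j closings, where j < u <= n. Appending an
    opening and then only closings turns the ballot words with u openings and
    j <= u closings into the Dyck words of semilength u + 1, so those with j < u
    number C_(u+1) - C_u. Summing over u from 1 to n gives
    C_(n+1) - C_1 = C_(n+1) - 1 ([size_prefixes]). *)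

(** * Pattern containment as a statement on subsequences *)

Lemma subseq_positionsP (w t : seq nat) :
  reflect (exists2 ix, sorted ltn ix && all (gtn (size w)) ix & t = map (nth 0 w) ix)
          (subseq t w).
Proof.
apply: (iffP idP) => [|[ix /andP[ixS ixw] ->]].
  rewrite -{1}(mkseq_nth 0 w) => /subseqP[m mw ->].
  exists (mask m (iota 0 (size w))); last by rewrite map_mask.
  apply/andP; split.
    exact: (subseq_sorted ltn_trans (mask_subseq _ _) (iota_ltn_sorted _ _)).
  by apply/allP => i /mem_mask; rewrite mem_iota.
suff -> : ix = filter [in ix] (iota 0 (size w)).
  by rewrite -{3}(mkseq_nth 0 w); apply/map_subseq/filter_subseq.
apply: (irr_sorted_eq ltn_trans ltnn ixS).
  exact: (sorted_filter ltn_trans _ (iota_ltn_sorted _ _)).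
move=> i; rewrite mem_filter mem_iota /= add0n.
by case: (boolP (i \in ix)) => // /(allP ixw).
Qed.

Lemma containsP (w s : seq nat) :
  reflect (exists t, [/\ subseq t w, size t = size s &
             forall r k, r < size s -> k < size s ->
               ((nth 0 t r < nth 0 t k) = (nth 0 s r < nth 0 s k)) /\
               ((nth 0 t r == nth 0 t k) = (nth 0 s r == nth 0 s k))])
          (contains w s).
Proof.
apply: (iffP existsP) => [[i /andP[/'forall_forallP mono /'forall_forallP iso]]|].
  pose f k := if insub k is Some r then val (i r) else 0.
  have fE (r : 'I_(size s)) : f r = i r by rewrite /f valK.
  exists [seq nth 0 w (f k) | k <- iota 0 (size s)]; split.
  - apply/subseq_positionsP; exists [seq f k | k <- iota 0 (size s)]; last first.
      by rewrite -map_comp.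
    apply/andP; split; last first.
      apply/allP => _ /mapP[k + ->]; rewrite mem_iota => /= ks.
      by rewrite (fE (Ordinal ks)).
    rewrite sorted_map; apply: (@sub_in_sorted _ (gtn (size s)) ltn) (iota_ltn_sorted _ _).
      move=> x y xs ys xy /=; rewrite /= (fE (Ordinal xs)) (fE (Ordinal ys)).
      exact: (implyP (mono (Ordinal xs) (Ordinal ys))).
    by apply/allP => k; rewrite mem_iota.
  - by rewrite size_map size_iota.
  - move=> r k rs ks; rewrite !(nth_map 0) ?size_iota // !nth_iota // !add0n.
    rewrite (fE (Ordinal rs)) (fE (Ordinal ks)).
    by have /andP[/eqP -> /eqP ->] := iso (Ordinal rs) (Ordinal ks).
case=> t [/subseq_positionsP[ix /andP[ixS ixw] ->]].
rewrite size_map => ixs iso.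
have ltw (r : 'I_(size s)) : nth 0 ix r < size w.
  by apply: (allP ixw); rewrite mem_nth // ixs.
exists [ffun r => Ordinal (ltw r)]; apply/andP; split.
  apply/'forall_forallP => r k; apply/implyP => rk; rewrite !ffunE /=.
  by apply: (sorted_ltn_nth ltn_trans) => //; rewrite inE ixs.
apply/'forall_forallP => r k; rewrite !ffunE /=.
have := iso r k (ltn_ord r) (ltn_ord k).
by rewrite !(nth_map 0) ?ixs // => -[-> ->]; rewrite !eqxx.
Qed.

(** For three distinct letters, [a a x y] is order-isomorphic to one of 1132,
    2213 and 2231: the three disjuncts, in this order. *)
Definition clash a x y := [|| a < y < x, x < a < y | y < a < x].

Definition admissible w :=
  (forall a b, a != b -> ~~ subseq [:: a; b; b; a] w) /\
  (forall a x y, clash a x y -> ~~ subseq [:: a; a; x; y] w).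

Lemma admissible_sub v w : subseq v w -> admissible w -> admissible v.
Proof.
by move=> vw [n1 n2]; split=> [a b ab | a x y /n2];
  [move: (n1 a b ab)|]; apply: contra => /subseq_trans; apply.
Qed.

Lemma admissibleP w :
  reflect (admissible w)
    ((avoids w [:: 1; 2; 2; 1] && avoids w [:: 2; 1; 1; 2]) &&
     all (avoids w) [:: [:: 1; 1; 3; 2]; [:: 2; 2; 1; 3]; [:: 2; 2; 3; 1]]).
Proof.
apply: (iffP idP) => [/and4P[/andP[h1 h2] h3 h4 /andP[h5 _]]|[n1 n2]].
  split=> [a b ab|a x y]; [|case/or3P] => [|xy|xy|xy]; apply/negP => sw.
  - have [lt|lt] : a < b \/ b < a by lia.
      apply: (negP h1); apply/containsP; exists [:: a; b; b; a]; split=> //.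
      by move=> [|[|[|[|r]]]] [|[|[|[|k]]]] //= _ _; split; lia.
    apply: (negP h2); apply/containsP; exists [:: a; b; b; a]; split=> //.
    by move=> [|[|[|[|r]]]] [|[|[|[|k]]]] //= _ _; split; lia.
  - apply: (negP h3); apply/containsP; exists [:: a; a; x; y]; split=> //.
    by move=> [|[|[|[|r]]]] [|[|[|[|k]]]] //= _ _; split; lia.
  - apply: (negP h4); apply/containsP; exists [:: a; a; x; y]; split=> //.
    by move=> [|[|[|[|r]]]] [|[|[|[|k]]]] //= _ _; split; lia.
  - apply: (negP h5); apply/containsP; exists [:: a; a; x; y]; split=> //.
    by move=> [|[|[|[|r]]]] [|[|[|[|k]]]] //= _ _; split; lia.
(* With equations between variables instead of repeated letters, the hypotheses
   given by order isomorphism turn into arithmetic side conditions. *)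
have nest a b c d : a = d -> b = c -> a != b -> ~~ subseq [:: a; b; c; d] w.
  by move=> <- <-; apply: n1.
have pat a b c d : a = b -> clash a c d -> ~~ subseq [:: a; b; c; d] w.
  by move=> <-; apply: n2.
rewrite /clash in pat.
apply/and4P; split; [apply/andP; split| | |rewrite andbT];
  apply/containsP => -[t [sw st iso]];
  move: t st iso sw => [|a1 [|a2 [|a3 [|a4 [|? ?]]]]] //= _ iso; apply/negP;
  move: (iso 0 1 isT isT) (iso 0 2 isT isT) (iso 0 3 isT isT)
        (iso 1 2 isT isT) (iso 1 3 isT isT) (iso 2 3 isT isT) => /= *;
  solve [apply: nest; lia | apply: pat; lia].
Qed.

(** * Closing the oldest open letter *)

Lemma subseq_cat_notin (T : eqType) (x : T) t q r :
  x \notin q -> subseq (x :: t) (q ++ r) -> subseq (x :: t) r.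
Proof.
elim: q => //= y q IH; rewrite inE negb_or => /andP[/negPf ne xq].
by rewrite ne; apply: IH.
Qed.

(** What the three patterns require of the word [r] that follows the second
    copy of [h]. *)
Definition closable h r := forall x y, clash h x y -> ~~ subseq [:: x; y] r.

(** Put the letters that are open, in their order of opening, in front of the
    part of the word still to be read: the result is again a word in which every
    letter occurs twice. If its next letter is the second copy of [h], the two copies of
    [h] can be removed at the price of the local condition [closable h r]. Indeed, an
    occurrence of a forbidden pattern that uses [h] uses it as the letter of the
    initial double: any other use of [h] would need two equal letters inside the
    duplicate-free [q], or an [h] inside [r]. *)
Lemma admissible_step h q r : h \notin q -> h \notin r -> uniq q ->
  admissible (h :: q ++ h :: r) <-> admissible (q ++ r) /\ closable h r.
Proof.
move=> hq hr uq; split=> [g|[g cl]].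
  split.
    apply: admissible_sub g; apply: subseq_trans (subseq_cons _ h).
    by apply: cat_subseq => //; apply: subseq_cons.
  move=> x y /g.2; apply: contra => s; rewrite /= eqxx.
  apply: (@subseq_trans _ (h :: r)); last exact: suffix_subseq.
  by rewrite /= eqxx.
have rem t : h \notin t -> subseq t (h :: q ++ h :: r) -> subseq t (q ++ r).
  move=> ht st; have : subseq t [seq x <- h :: q ++ h :: r | x != h].
    by rewrite subseq_filter st andbT; apply/allP => x xt; apply: contraNneq ht => <-.
  rewrite /= filter_cat /= eqxx /=.
  have keep s : h \notin s -> [seq x <- s | x != h] = s.
    by move=> hs; apply/all_filterP/allP => x; apply: contraTneq => ->.
  by rewrite !keep.
(* Only [q] lies between the two copies of [h]: no letter is repeated there. *)
have once a : a != h -> ~~ subseq [:: a; a; h] (q ++ h :: r).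
  move=> ah; apply/negP; have rqr : rev (q ++ h :: r) = rev r ++ h :: rev q.
    by rewrite rev_cat rev_cons cat_rcons.
  rewrite -subseq_rev rqr => /subseq_cat_notin; rewrite mem_rev => /(_ hr).
  rewrite /= eqxx => /subseq_uniq.
  by rewrite rev_uniq uq /= inE eqxx => /(_ isT).
have sub3 t a : a != h -> subseq (a :: t) (h :: q ++ h :: r) ->
    subseq (a :: t) (q ++ h :: r).
  by move=> /negPf ah; rewrite [X in X -> _]/= ah.
split=> [a b ab|a x y bxy]; apply/negP => sw.
  have [ah|ah] := eqVneq a h.
    subst a; move: sw; rewrite /= eqxx => sw; have := once b.
    by rewrite eq_sym ab sw => /(_ isT).
  have {}sw := sub3 _ _ ah sw.
  have [bh|bh] := eqVneq b h.
    subst b; have : subseq [:: h; h] (q ++ h :: r).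
      apply: subseq_trans sw; apply: subseq_trans (subseq_cons _ _).
      exact: (@prefix_subseq _ [:: h; h] [:: a]).
    by move/(subseq_cat_notin hq); rewrite /= eqxx sub1seq (negPf hr).
  have /negP[] := g.1 a b ab; apply: rem; last exact: subseq_trans sw (subseq_cons _ _).
  by rewrite !inE !negb_or ![h == _]eq_sym ah bh.
have [ah|ah] := eqVneq a h.
  subst a; move: sw; rewrite /= eqxx => /(subseq_cat_notin hq); rewrite /= eqxx.
  by move=> sw; have /negP[] := cl x y bxy.
have {}sw := sub3 _ _ ah sw.
have [xh|xh] := eqVneq x h.
  subst x; have /negP[] := once a ah; apply: subseq_trans sw.
  exact: (@prefix_subseq _ [:: a; a; h] [:: y]).
have [yh|yh] := eqVneq y h.
  subst y; have /negP[] := once a ah; apply: subseq_trans sw.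
  by rewrite /= !eqxx [h == x]eq_sym (negPf xh) eqxx.
have /negP[] := g.2 a x y bxy; apply: rem; last exact: subseq_trans sw (subseq_cons _ _).
by rewrite !inE !negb_or ![h == _]eq_sym ah xh yh.
Qed.

(** * Nonnesting words as runs of a queue *)

(** A nonnesting word closes its letters in the order in which it opens them, so
    it is the trace of a queue: [fifo q a d w] says that [w] is read from the
    state where [q] lists the open letters, the oldest one first, and [a] the
    letters to be opened, in order; the entry of [d] is [true] where [w] shows a
    first copy and [false] where it shows a second copy. *)
Inductive fifo : seq nat -> seq nat -> seq bool -> seq nat -> Prop :=
| fifo_nil : fifo [::] [::] [::] [::]
| fifo_open q x a d w :
    fifo (rcons q x) a d w -> fifo q (x :: a) (true :: d) (x :: w)
| fifo_close q h a d w :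
    fifo q a d w -> fifo (h :: q) a (false :: d) (h :: w).

Lemma fifo_perm q a d w : fifo q a d w -> perm_eq w (q ++ a ++ a).
Proof.
elim=> {q a d w} [|q x a d w _ IH|q h a d w _ IH] //.
  apply/permP => P; move/permP: IH => /(_ P).
  by rewrite !count_cat -cats1 !count_cat /=; lia.
by rewrite /= perm_cons.
Qed.

(** The second copies alone spell [q ++ a]. *)
Lemma fifo_subseq q a d w : fifo q a d w -> subseq (q ++ a) w.
Proof.
elim=> {q a d w} [|q x a d w _ IH|q h a d w _ IH] //; last by rewrite /= eqxx.
by rewrite -cat_rcons; apply: subseq_trans IH (subseq_cons _ _).
Qed.

Lemma fifo_mem q a d w : fifo q a d w -> w =i q ++ a.
Proof.
by move/fifo_perm/perm_mem => E x; rewrite E !mem_cat orbb.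
Qed.

(** A letter is in the queue exactly when its first copy has been read, so a
    word determines the moves and the opening order that produce it. *)
Lemma fifo_inj q a a' d d' w : uniq (q ++ a) -> uniq (q ++ a') ->
  fifo q a d w -> fifo q a' d' w -> a = a' /\ d = d'.
Proof.
move=> + + f; elim: f a' d' => {q a d w} [|q x a d w f IH|q h a d w f IH] a' d' ua ua' f'.
- by inversion f'.
- inversion f'; subst; last first.
    by move: ua; rewrite /= mem_cat mem_head orbT.
  have [|||-> ->] // := IH a0 d0; by rewrite cat_rcons.
- inversion f'; subst.
    by move: ua'; rewrite /= mem_cat mem_head orbT.
  have [|||-> ->] // := IH a' d0.
    by case/andP: ua.
  by case/andP: ua'.
Qed.

Fixpoint fifo_word q a d : seq nat :=
  match d, a, q with
  | true :: d', x :: a', _ => x :: fifo_word (rcons q x) a' d'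
  | false :: d', _, h :: q' => h :: fifo_word q' a d'
  | _, _, _ => [::]
  end.

Lemma fifo_wordE q a d w : fifo q a d w -> w = fifo_word q a d.
Proof. by elim=> {q a d w} //= q h a d w _ ->. Qed.

(** A letter being closed must be the head [h] of the queue: if it were another
    letter [x], the second copy of [h] would still be to come, and [h x x h] would
    be a nesting. *)
Lemma fifo_exists q w : uniq q -> {in q ++ w, forall x, count_mem x (q ++ w) = 2} ->
  (forall a b, a != b -> ~~ subseq [:: a; b; b; a] (q ++ w)) ->
  exists a d, fifo q a d w.
Proof.
elim: w q => [|x w IH] q uq two nest.
  case: q uq two {nest} => [_ _|h q uq two]; first by exists [::], [::]; constructor.
  by have := two h; rewrite cats0 mem_head count_uniq_mem // mem_head => /(_ isT).
have [|xq] := boolP (x \in q); last first.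
  have [|||a [d f]] := IH (rcons q x).
  - by rewrite rcons_uniq xq.
  - by rewrite cat_rcons.
  - by rewrite cat_rcons.
  - by exists (x :: a), (true :: d); constructor.
case: q => [|h q] // in uq two nest *; rewrite inE; have [xh _|xh /= xq] := eqVneq x h.
  subst x.
  have step y : count_mem y (h :: q ++ h :: w) = (h == y).*2 + count_mem y (q ++ w).
    by rewrite /= !count_cat /=; lia.
  have [|y yqw|a b ab|a [d f]] := IH q.
  - by case/andP: uq.
  - have yqhw : y \in h :: q ++ h :: w.
      by move: yqw; rewrite !(inE, mem_cat) => /orP[->|->]; rewrite !orbT.
    have := two y yqhw; rewrite cat_cons step; move: yqw.
    by rewrite -has_pred1 has_count; case: (h == y) => /=; lia.
  - apply: contra (nest a b ab) => sw; apply: subseq_trans sw _.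
    apply: subseq_trans (subseq_cons _ h).
    by apply: cat_subseq => //; apply: subseq_cons.
  - by exists a, (false :: d); constructor.
have hw : h \in w.
  have := two h (mem_head _ _); rewrite cat_cons /= eqxx count_cat /= (negPf xh).
  move: uq => /= /andP[/count_memPn -> _].
  by rewrite !add0n add1n -has_pred1 has_count => -[->].
have := nest h x; rewrite eq_sym xh => /(_ isT) /negP[].
have sw : subseq ([:: x] ++ [:: x; h]) (q ++ x :: w).
  by apply: cat_subseq; rewrite ?sub1seq //= eqxx sub1seq.
by rewrite [X in is_true X]/= eqxx.
Qed.

(** * The shape of the admissible words *)

Notation ups := (count id).
Notation downs := (count negb).

Fixpoint ballot h (p : seq bool) :=
  if p is x :: p' then if x then ballot h.+1 p' else (0 < h) && ballot h.-1 p'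
  else true.

(** The moves that empty a queue of [h] letters and then open and close at once
    each of the [m] remaining letters. *)
Definition flush h m := nseq h false ++ flatten (nseq m [:: true; false]).

Definition dbl (a : seq nat) := flatten [seq [:: x; x] | x <- a].

Lemma fifo_flush q a : fifo q a (flush (size q) (size a)) (q ++ dbl a).
Proof.
elim: q => [|h q IH]; last exact: fifo_close.
by elim: a => [|x a IH]; [apply: fifo_nil | apply/fifo_open/fifo_close].
Qed.

Lemma sorted_dbl q a : sorted ltn (q ++ a) -> sorted leq (q ++ dbl a).
Proof.
have cons x s r : s =i r -> path ltn x r -> sorted leq s -> path leq x s.
  move=> sr; rewrite !path_sortedE; [|exact: leq_trans|exact: ltn_trans].
  by case/andP=> lt _ ->; rewrite (eq_all_r sr) (sub_all _ lt) // => y /ltnW.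
elim: q => [|h q IH] /= srt; last first.
  by apply: (cons _ _ _ (fifo_mem (fifo_flush q a)) srt); apply/IH/path_sorted/srt.
elim: a srt => //= x a IH srt; rewrite leqnn /=.
exact: (cons _ _ _ (fifo_mem (fifo_flush [::] a)) srt (IH (path_sorted srt))).
Qed.

(** When the letters are opened in increasing order, flushing is the only way to
    produce a weakly increasing word: opening a letter while a smaller one is open
    creates a descent. The proof compares [w] with the sorted word that has the
    same letters. *)
Lemma flush_sorted q a d w : sorted ltn (q ++ a) -> fifo q a d w ->
  (d == flush (size q) (size a)) = sorted leq w.
Proof.
move=> sqa f; have fl := fifo_flush q a.
have uqa : uniq (q ++ a) := sorted_uniq ltn_trans ltnn sqa.
apply/eqP/idP => [dE|sw].
  by rewrite (fifo_wordE f) dE -(fifo_wordE fl) sorted_dbl.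
suff wE : w = q ++ dbl a by rewrite wE in f; have [] := fifo_inj uqa uqa f fl.
apply: (sorted_eq leq_trans anti_leq sw (sorted_dbl sqa)).
by apply: perm_trans (fifo_perm f) _; rewrite perm_sym (fifo_perm fl).
Qed.

Fixpoint falls_then_rises j (b : seq nat) :=
  match j, b with
  | 0, _ => sorted ltn b
  | j'.+1, h :: b' => all (gtn h) b' && falls_then_rises j' b'
  | _.+1, [::] => false
  end.

(** Once a letter smaller than all the following ones is closed, avoiding 1132
    forces the rest of the word to be weakly increasing; 2213 and 2231 are then
    out of the question. *)
Lemma closable_min h w : all (ltn h) w -> closable h w <-> sorted leq w.
Proof.
move=> /allP hw; split=> [cl|sw x y bxy].
  rewrite sorted_pairwise; last exact: leq_trans.
  elim: w hw cl => //= x w IH hw cl; apply/andP; split; last first.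
    apply: IH => [y yw|y z b]; first by apply: hw; rewrite inE yw orbT.
    by apply: contra (cl y z b) => /subseq_trans; apply; apply: subseq_cons.
  apply/allP => y yw; rewrite leqNgt; apply/negP => yx.
  have /cl/negP[] : clash h x y by rewrite /clash yx hw ?orbT // inE yw orbT.
  by rewrite /= eqxx sub1seq.
apply/negP => sub; have xy : x <= y.
  by have := subseq_sorted leq_trans sub sw; rewrite /= andbT.
have /= := hw x (mem_subseq sub (mem_head _ _)).
have /= : h < y by apply/hw/(mem_subseq sub); rewrite !inE eqxx orbT.
move: bxy; rewrite /clash /=; lia.
Qed.

(** Each of 1132, 2213 and 2231 has a letter above the doubled one. *)
Lemma closable_max h w : all (gtn h) w -> closable h w.
Proof.
move=> /allP hw x y bxy; apply/negP => sub.
have /= := hw x (mem_subseq sub (mem_head _ _)).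
have /= : y < h by apply/hw/(mem_subseq sub); rewrite !inE eqxx orbT.
by move: bxy; rewrite /clash /=; lia.
Qed.

(** A smaller and a larger letter after the second copy of [h], in whichever
    order, would form 2213 or 2231. *)
Lemma closable_extreme h w : h \notin w -> closable h w ->
  all (gtn h) w \/ all (ltn h) w.
Proof.
move=> hw cl; have [|/allPn[y yw]] := boolP (all (gtn h) w); first by left.
have ne z : z \in w -> z != h by apply: contraTneq => ->.
move=> /= yh; right; apply/allP => x xw; rewrite /= ltnNge; apply/negP => xh.
have := (ne x xw); have := ne y yw => neyh nexh.
have xy : x != y by apply/eqP=> e; subst; lia.
have [sub|sub] : subseq [:: x; y] w \/ subseq [:: y; x] w.
- elim: w xw yw {hw cl ne} => //= z w IH; rewrite !inE.
  have [e|xz] := eqVneq x z.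
    by subst z; rewrite [y == x]eq_sym (negPf xy) /= => _ yw; left; rewrite sub1seq.
  have [e|yz] := eqVneq y z; first by subst z => /= xw _; right; rewrite sub1seq.
  exact: IH.
- by apply: (negP (cl x y _) sub); rewrite /clash /=; lia.
- by apply: (negP (cl y x _) sub); rewrite /clash /=; lia.
Qed.

Lemma all_gt_head_sorted h q a : sorted ltn (h :: q ++ a) -> all (ltn h) (q ++ a).
Proof. by rewrite /= path_sortedE; [case/andP|exact: ltn_trans]. Qed.

(** Induction along the run. A letter closed by the run is larger than all the
    letters still to be closed, and then is one more initial maximum, or smaller
    than all of them, and then the rest of the word is sorted, which forces the
    letters to be in increasing order and the moves to be a flush. The free
    part [p] of the run is what precedes this second case. The inequality
    [downs p < size q + ups p] says that the letter closed by the first move of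
    the flush is open at the end of [p]: so the flush starts with a closing move,
    and [p] can be recovered from [d] (see [prefix_inj]). *)
Lemma admissible_shape q a d w : fifo q a d w -> uniq (q ++ a) -> admissible (q ++ w) ->
  0 < size (q ++ a) ->
  exists p, [/\ ballot (size q) p, downs p < size q + ups p, ups p <= size a,
    d = p ++ flush (size q + ups p - downs p) (size a - ups p) &
    falls_then_rises (downs p) (q ++ a)].
Proof.
elim=> {q a d w} [|q x a d w f IH|q h a d w f IH] //.
  rewrite -cat_rcons => u g s; have [|p [bp lt le dE sp]] := IH u _ s; first by rewrite cat_rcons.
  exists (true :: p); rewrite size_rcons in bp lt dE; split=> //=; try lia.
  by rewrite dE; congr (_ :: _ ++ flush _ _); lia.
move=> /= /andP[hqa uqa] g _.
have memw := fifo_mem f.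
have hw : h \notin w by rewrite memw.
have hq : h \notin q by move: hqa; rewrite mem_cat negb_or => /andP[].
have uq : uniq q by move: uqa; rewrite cat_uniq => /and3P[].
have [{}g cl] := (admissible_step hq hw uq).1 g.
have [/nilP qa0|] := boolP (nilp (q ++ a)).
  have {}memw : w = [::] by case: w memw {f IH g hw cl} => // y w /(_ y); rewrite qa0 mem_head.
  case: q qa0 f {IH g hq uq uqa hqa} => // qa0 f; rewrite qa0 memw in f *.
  by inversion f; exists [::].
rewrite /nilp -lt0n => /(IH uqa g) {IH}[p [bp lt le dE sp]].
have [mx|mn] := closable_extreme hw cl.
  exists (false :: p); split=> //=; try lia.
    by rewrite dE; congr (_ :: _ ++ flush _ _); lia.
  by rewrite sp andbT -(eq_all_r memw).
have sw := (closable_min mn).1 cl.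
have sqa : sorted ltn (h :: q ++ a).
  rewrite /= path_sortedE; last exact: ltn_trans.
  rewrite -(eq_all_r memw) mn /= ltn_sorted_uniq_leq uqa /=.
  exact: (subseq_sorted leq_trans (fifo_subseq f) sw).
exists [::]; split=> //=.
rewrite addn0 !subn0 /=; congr (_ :: _); apply/eqP.
by rewrite (flush_sorted _ f) //; apply: path_sorted sqa.
Qed.

(** Conversely, a letter closed during [p] is a maximum of what remains, and a
    letter closed during the flush is followed by a sorted word of larger letters;
    in both cases no forbidden pattern starts with it. The inequality is weak
    because the flush phase of the induction passes through the state with an
    empty queue. *)
Lemma shape_admissible q a d w p : fifo q a d w -> uniq (q ++ a) ->
  downs p <= size q + ups p -> ups p <= size a ->
  d = p ++ flush (size q + ups p - downs p) (size a - ups p) ->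
  falls_then_rises (downs p) (q ++ a) -> admissible (q ++ w).
Proof.
move=> f; elim: f p => {q a d w} [|q x a d w f IH|q h a d w f IH] p.
- by move=> *; split.
- rewrite -!cat_rcons; case: p => [|[] p] //= u le1 le2; rewrite ?addn0 ?subn0.
    case: q => // in f IH u le1 *; move=> [dE] sp.
    by apply: (IH [::]); rewrite /= ?subn0.
  move=> [dE]; apply: IH => //=; rewrite ?size_rcons; try lia.
  by rewrite dE; congr (_ ++ flush _ _); lia.
move=> /= /andP[hqa uqa].
have memw := fifo_mem f.
have hw : h \notin w by rewrite memw.
have hq : h \notin q by move: hqa; rewrite mem_cat negb_or => /andP[].
have uq : uniq q by move: uqa; rewrite cat_uniq => /and3P[].
move=> le1 le2 dE sp; apply/(admissible_step hq hw uq).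
case: p => [|[] p] //= in le1 le2 dE sp *.
  rewrite addn0 !subn0 /= in dE; case: dE => dE.
  have mn : all (ltn h) w by rewrite (eq_all_r memw) all_gt_head_sorted.
  split; first by apply: (IH [::]); rewrite //= ?addn0 ?subn0 //; apply: path_sorted sp.
  by apply/closable_min; rewrite // -(flush_sorted (path_sorted sp) f) dE.
case/andP: sp => mx sp; case: dE => dE; split.
  exact: (IH p).
by apply: closable_max; rewrite (eq_all_r memw).
Qed.

Lemma fifo_shape q a p : ballot (size q) p -> ups p <= size a ->
  exists w, fifo q a (p ++ flush (size q + ups p - downs p) (size a - ups p)) w.
Proof.
elim: p q a => [|[] p IH] q a /= bp le.
- by exists (q ++ dbl a); rewrite addn0 !subn0; apply: fifo_flush.
- case: a le => // x a le; rewrite -(size_rcons q x) in bp.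
  have [|w] := IH (rcons q x) a bp; first by [].
  rewrite size_rcons => f; exists (x :: w); apply: fifo_open.
  by congr fifo: f; congr (_ ++ flush _ _); rewrite /=; lia.
- case: q bp => // h q bp; have [|w f] := IH q a bp; first by [].
  exists (h :: w); apply: fifo_close.
  by congr fifo: f; congr (_ ++ flush _ _); rewrite /=; lia.
Qed.

(** * Encoding the admissible words by ballot prefixes *)

(** The word n, n-1, ..., n-j+1, 1, 2, ..., n-j. *)
Fixpoint fall_rise n j :=
  match j, n with
  | j'.+1, n'.+1 => n :: fall_rise n' j'
  | _, _ => iota 1 n
  end.

Lemma perm_fall_rise n j : perm_eq (fall_rise n j) (iota 1 n).
Proof.
elim: j n => [|j IH] [|n] //; rewrite -[X in iota _ X]addn1 iotaD perm_sym perm_catC.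
by rewrite /= add1n perm_sym perm_cons.
Qed.

Lemma falls_then_rises_fall_rise n j : j <= n -> falls_then_rises j (fall_rise n j).
Proof.
elim: j n => [|j IH] [|n] // jn; first exact: iota_ltn_sorted.
rewrite /= IH // andbT; apply/allP => x; rewrite (perm_mem (perm_fall_rise n j)) mem_iota /=.
by lia.
Qed.

Lemma falls_then_rises_eq n j b :
  perm_eq b (iota 1 n) -> falls_then_rises j b -> b = fall_rise n j.
Proof.
elim: j n b => [|j IH] n b pb /=.
  move=> sb; have -> : fall_rise n 0 = iota 1 n by case: n {pb}.
  exact: (irr_sorted_eq ltn_trans ltnn sb (iota_ltn_sorted 1 n) (perm_mem pb)).
case: b pb => // h b pb /andP[mx sp].
case: n pb => [|n] pb; first by move/perm_size: pb.
have hE : h = n.+1.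
  have := perm_mem pb h; rewrite mem_head mem_iota.
  have := perm_mem pb n.+1; rewrite mem_iota inE.
  have [//|/= _] := eqVneq n.+1 h; have [/(allP mx) /=|] := boolP (n.+1 \in b); by lia.
rewrite /= -hE (IH n b _ sp) //; subst h.
move: pb; rewrite -[X in iota _ X]addn1 iotaD perm_sym perm_catC /= add1n perm_cons.
by rewrite perm_sym.
Qed.

Lemma fall_rise_inj n i j : i < n -> j < n -> fall_rise n i = fall_rise n j -> i = j.
Proof.
elim: i n j => [|i IH] [|n] [|j] //=; try by (move=> ? ? []; lia).
by move=> ? ? [/IH ->].
Qed.

(** The prefix [p] determines the opening order through its number of second
    copies, which is the number of initial maxima. *)
Definition prefix_word n p :=
  fifo_word [::] (fall_rise n (downs p)) (p ++ flush (ups p - downs p) (n - ups p)).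

Lemma ballot_rcons h p x :
  ballot h (rcons p x) = ballot h p && (x || (downs p < h + ups p)).
Proof.
elim: p h => [|[] p IH] h /=; first by case: x; rewrite ?andbT ?addn0.
  by rewrite IH; congr (_ && (_ || _)); lia.
by rewrite IH; case: h => //= h; congr (_ && (_ || _)); lia.
Qed.

(** [p] is the part before the [false] number [downs p + 1]. *)
Lemma prefix_inj p p' r r' : downs p = downs p' ->
  p ++ false :: r = p' ++ false :: r' -> p = p'.
Proof.
elim: p p' => [|[] p IH] [|[] p'] //= e []; rewrite ?add0n ?add1n in e *.
  by move/IH => ->.
by move/IH => -> //; case: e.
Qed.

(** * Counting ballot prefixes *)

(** The ballot words with [u] entries [true] and [v] entries [false], built
    from the last entry, so that the counting recurrence is Pascal's. *)
Fixpoint ballots u v : seq (seq bool) :=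
  if u is u'.+1 then
    (fix go v := [seq rcons p true | p <- ballots u' v] ++
       (if v is v'.+1 then
          if v' <= u' then [seq rcons p false | p <- go v'] else [::]
        else [::])) v
  else if v is 0 then [:: [::]] else [::].

Lemma ballotsS0 u : ballots u.+1 0 = [seq rcons p true | p <- ballots u 0].
Proof. by rewrite /= cats0. Qed.

Lemma ballotsSS u v : ballots u.+1 v.+1 = [seq rcons p true | p <- ballots u v.+1] ++
  (if v <= u then [seq rcons p false | p <- ballots u.+1 v] else [::]).
Proof. by []. Qed.

Lemma mem_ballots u v p :
  (p \in ballots u v) = [&& ballot 0 p, ups p == u & downs p == v].
Proof.
have mem_rcons_map x y (L : seq (seq bool)) q :
    (rcons q x \in [seq rcons p y | p <- L]) = (x == y) && (q \in L).
  apply/mapP/andP => [[r rL /rcons_inj[-> ->]]|[/eqP -> qL]]; by [|exists q].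
have nil_map y (L : seq (seq bool)) : ([::] \in [seq rcons p y | p <- L]) = false.
  by apply/negP => /mapP[[]].
elim/last_ind: p u v => [|p x IH] u v.
  case: u => [|u]; case: v => [|v] //.
    by rewrite ballotsS0 nil_map.
  by rewrite ballotsSS mem_cat nil_map; case: ifP; rewrite ?nil_map.
rewrite ballot_rcons -cats1 !count_cat cats1 /= !addn0.
case: u => [|u].
  have -> : (rcons p x \in ballots 0 v) = false by case: v => [|v] //; case: p {IH}.
  by symmetry; apply/negbTE; case: x; lia.
case: v => [|v].
  rewrite ballotsS0 mem_rcons_map IH; case: x => /=; last by lia.
  by rewrite addn0 addn1 andbT eqSS.
rewrite ballotsSS mem_cat mem_rcons_map IH.
have -> : (rcons p x \in (if v <= u then [seq rcons q false | q <- ballots u.+1 v] else [::]))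
   = [&& v <= u, x == false & p \in ballots u.+1 v].
  by case: ifP => // _; rewrite mem_rcons_map.
rewrite IH; case: x => /=; rewrite ?andbF ?orbF ?addn0 ?addn1 ?andbT ?eqSS //.
by case: (ballot 0 p) => //=; lia.
Qed.

Lemma uniq_ballots u v : uniq (ballots u v).
Proof.
elim: u v => [|u IH]; first by case.
have um y (L : seq (seq bool)) : uniq L -> uniq [seq rcons p y | p <- L].
  by rewrite map_inj_uniq //; apply: rcons_injl.
elim=> [|v IHv]; first by rewrite ballotsS0 um.
rewrite ballotsSS; case: ifP => _; last by rewrite cats0 um.
rewrite cat_uniq !um //= andbT; apply/hasPn => _ /mapP[p _ ->].
by apply/negP => /mapP[q _ /rcons_inj[]].
Qed.

Lemma size_ballotsSS u v : v <= u ->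
  size (ballots u.+1 v.+1) = size (ballots u v.+1) + size (ballots u.+1 v).
Proof. by move=> vu; rewrite ballotsSS vu size_cat !size_map. Qed.

Lemma size_ballots0 u : size (ballots u 0) = 1.
Proof. by elim: u => // u IH; rewrite ballotsS0 size_map. Qed.

Lemma ballots_gt u v : u < v -> ballots u v = [::].
Proof.
elim: u v => [|u IH] [|v] // uv.
by rewrite ballotsSS IH ?[v <= u]leqNgt ?(uv : u < v) // leqW.
Qed.

(** The ballot formula, written as a sum because of the truncated subtraction.
    The boundary case, one more down than ups, is where the symmetry of the
    binomial coefficients replaces the recurrence. *)
Lemma size_ballots_bin u v : v <= u ->
  size (ballots u v.+1) + 'C(u + v.+1, v) = 'C(u + v.+1, v.+1).
Proof.
elim: u v => [|u IHu] v; first by case: v.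
elim: v => [|v IHv] vu.
  have := IHu 0 isT; rewrite size_ballotsSS // size_ballots0 !bin0 !bin1; lia.
have [ltvu|geuv] := ltnP v u.
  have := IHu v.+1 ltvu; have := IHv (ltnW vu); rewrite (size_ballotsSS ltvu).
  rewrite !addSn !addnS !binS; lia.
have -> : v = u by lia.
rewrite ballots_gt // add0n -bin_sub; last by lia.
by congr (binomial _ _); lia.
Qed.

(** A ballot word with as many downs as ups ends with a down. *)
Lemma size_ballots_diag u : size (ballots u.+1 u.+1) = size (ballots u.+1 u).
Proof. by rewrite size_ballotsSS // ballots_gt. Qed.

(** Unfolding the recurrence. A bijective reading: cut a ballot word with [u + 1]
    ups and [v] downs at its last up; what precedes it has [u] ups and some
    number [i <= v] of downs, and determines the word. *)
Lemma sum_ballots u v : v <= u ->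
  \sum_(i <- iota 0 v.+1) size (ballots u i) = size (ballots u.+1 v).
Proof.
elim: v => [|v IH] vu; first by rewrite big_seq1 !size_ballots0.
have vu' := ltnW vu.
by rewrite -[v.+2]addn1 iotaD big_cat big_seq1 IH //= addnC size_ballotsSS.
Qed.

Lemma catalan_ballots u : size (ballots u u) = catalan u.
Proof.
have e : u.+1 * size (ballots u u) = 'C(2 * u, u); last by rewrite /catalan -e mulKn.
case: u => [|u] //.
have := size_ballots_bin (leqnSn u); rewrite addnn -mul2n => e.
have := mul_bin_left (2 * u.+1) u; have -> : 2 * u.+1 - u = u.+2 by lia.
by rewrite -e; nia.
Qed.

(** The free parts of the runs that produce the admissible words. *)
Definition prefixes n :=
  [seq p | u <- iota 1 n, p <- flatten [seq ballots u v | v <- iota 0 u]].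

Lemma mem_prefixes n p : (p \in prefixes n) = [&& ballot 0 p, downs p < ups p & ups p <= n].
Proof.
apply/allpairsPdep/and3P => [[u [q [un /flattenP[_ /mapP[v vu ->] pb ->]]]]|[bp lt le]].
  move: pb; rewrite mem_ballots => /and3P[-> /eqP -> /eqP ->].
  by move: un vu; rewrite !mem_iota; split; lia.
exists (ups p), p; split=> //; first by rewrite mem_iota; lia.
apply/flatten_mapP; exists (downs p); first by rewrite mem_iota.
by rewrite mem_ballots bp !eqxx.
Qed.

Lemma uniq_prefixes n : uniq (prefixes n).
Proof.
apply: allpairs_uniq_dep => [|u _|]; first exact: iota_uniq.
  have -> : flatten [seq ballots u v | v <- iota 0 u] =
            [seq p | v <- iota 0 u, p <- ballots u v].
    by congr flatten; apply: eq_map => v; rewrite map_id.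
  apply: allpairs_uniq_dep => [|v _|]; [exact: iota_uniq|exact: uniq_ballots|].
  move=> _ _ /allpairsPdep[v [p [_ pv ->]]] /allpairsPdep[v' [p' [_ pv' ->]]] /= e.
  move: pv pv'; rewrite -{}e !mem_ballots => /and3P[_ _ /eqP <-] /and3P[_ _ /eqP <-].
  by [].
have mem u p : p \in flatten [seq ballots u v | v <- iota 0 u] -> ups p = u.
  by case/flatten_mapP => v _; rewrite mem_ballots => /and3P[_ /eqP].
move=> _ _ /allpairsPdep[u [p [_ pu ->]]] /allpairsPdep[u' [p' [_ pu' ->]]] /= e.
by move: pu pu'; rewrite -{}e => /mem <- /mem <-.
Qed.

(** By [sum_ballots], the prefixes with [u] ups number C_(u+1) - C_u, since those
    with [u] downs are left out; the sum over [u] telescopes. *)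
Lemma size_prefixes n : (size (prefixes n)).+1 = catalan n.+1.
Proof.
rewrite size_allpairs_dep -catalan_ballots sumnE big_map.
elim: n => [|n IH]; first by rewrite big_nil.
rewrite -[X in iota _ X]addn1 iotaD big_cat big_seq1 -addSn IH add1n.
rewrite size_flatten /shape -map_comp sumnE big_map /=.
rewrite [RHS]size_ballots_diag -sum_ballots // -[n.+2]addn1 iotaD big_cat big_seq1.
by rewrite addnC.
Qed.

Lemma perm_double n : perm_eq (double_multiset n) (iota 1 n ++ iota 1 n).
Proof. exact: fifo_perm (fifo_flush [::] (iota 1 n)). Qed.

Lemma fifo_prefix_word n p : p \in prefixes n ->
  fifo [::] (fall_rise n (downs p)) (p ++ flush (ups p - downs p) (n - ups p))
    (prefix_word n p).
Proof.
rewrite mem_prefixes => /and3P[bp _ le].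
have szs : size (fall_rise n (downs p)) = n by rewrite (perm_size (perm_fall_rise _ _)) size_iota.
have [|w] := @fifo_shape [::] (fall_rise n (downs p)) p bp; first by rewrite szs.
by rewrite szs add0n => f; rewrite /prefix_word -(fifo_wordE f).
Qed.

Lemma uniq_fall_rise n j : uniq (fall_rise n j).
Proof. by rewrite (perm_uniq (perm_fall_rise n j)) iota_uniq. Qed.

Lemma prefix_word_inj n : {in prefixes n &, injective (prefix_word n)}.
Proof.
move=> p p' pP p'P e; have f := fifo_prefix_word pP; have f' := fifo_prefix_word p'P.
rewrite -e in f'; have [] := fifo_inj _ _ f f'; rewrite ?uniq_fall_rise //.
move: pP p'P; rewrite !mem_prefixes => /and3P[_ lt le] /and3P[_ lt' le'].
move=> skE dE; have dd : downs p = downs p'.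
  by apply: fall_rise_inj skE; lia.
have head_flush (q : seq bool) : downs q < ups q -> exists r,
    flush (ups q - downs q) (n - ups q) = false :: r.
  by rewrite -subn_gt0; case: (_ - _) => // m _; eexists.
have [[r rE] [r' rE']] := (head_flush p lt, head_flush p' lt').
by apply: (@prefix_inj p p' r r' dd); rewrite -rE -rE'.
Qed.

(** * The admissible words are the words of the prefixes *)

Lemma mem_prefix_word n w : 0 < n ->
  (w \in [seq prefix_word n p | p <- prefixes n]) <->
  perm_eq w (double_multiset n) /\ admissible w.
Proof.
move=> n0; split=> [/mapP[p pP ->]|[pw gw]].
  have f := fifo_prefix_word pP; have ps := perm_fall_rise n (downs p).
  move: pP; rewrite mem_prefixes => /and3P[bp lt le].
  split.
    rewrite (permPl (fifo_perm f)) (permPr (perm_double n)) /=.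
    exact: perm_cat.
  have szs : size (fall_rise n (downs p)) = n by rewrite (perm_size ps) size_iota.
  apply: (shape_admissible (p := p) f); rewrite ?uniq_fall_rise ?szs ?add0n //; first exact: ltnW.
  by apply: falls_then_rises_fall_rise; lia.
have cw x : count_mem x w = (x \in iota 1 n).*2.
  rewrite (permP pw) (permP (perm_double n)) count_cat addnn.
  by rewrite count_uniq_mem ?iota_uniq.
have [|x|a b|a [d f]] := @fifo_exists [::] w; first by [].
- by rewrite /= -has_pred1 has_count cw; case: (x \in _).
- exact: gw.1.
have pa : perm_eq a (iota 1 n).
  apply/permP => P; have := permP (fifo_perm f) P.
  rewrite (permP pw) (permP (perm_double n)) !count_cat /=; lia.
have ua : uniq a by rewrite (perm_uniq pa) iota_uniq.
have sza : size a = n by rewrite (perm_size pa) size_iota.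
have [|p [bp lt le dE sp]] := admissible_shape f ua gw; first by rewrite /= sza.
rewrite /= !add0n sza in lt le dE.
have skE := falls_then_rises_eq pa sp.
apply/mapP; exists p; first by rewrite mem_prefixes bp lt le.
by rewrite (fifo_wordE f) skE dE.
Qed.

Theorem theorem3p14 (n : nat) (hn : 1 <= n) :
  c n [:: [:: 1; 1; 3; 2]; [:: 2; 2; 1; 3]; [:: 2; 2; 3; 1]]
  = catalan n.+1 - 1.
Proof.
rewrite -size_prefixes subn1 /= -(size_map (prefix_word n)) /c.
apply/perm_size/uniq_perm => [||w].
- by rewrite !filter_uniq // permutations_uniq.
- by rewrite map_inj_in_uniq ?uniq_prefixes //; apply: prefix_word_inj.
rewrite !mem_filter mem_permutations andbA andbC [X in _ && X]andbC.
apply/andP/idP => [[pw /admissibleP gw]|]; first exact/mem_prefix_word.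
by case/(mem_prefix_word _ hn) => pw /admissibleP.
Qed.
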